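(* For any constant $\tau>0$, there is a deterministic CONGEST algorithm that, on an $n$-node graph with arboricity $\alpha$ and nonnegative node weights, computes an $O(\alpha)$-approximation for MWIS in $O(\alpha^{\tau}\log n)$ rounds.
   Context: The arboricity $\alpha$ of a graph is the smallest integer such that its edge set can be partitioned into $\alpha$ forests. MWIS: given weights $w:V\to\mathbb{R}_{\geq0}$, $OPT(G)$ is the maximum of $w(I)=\sum_{v\in I}w(v)$ over independent sets $I$; an independent set $X$ is a $q$-approximation if $q\cdot w(X)\geq OPT(G)$. CONGEST model: synchronous rounds on the network graph, unique $O(\log n)$-bit identifiers, $O(\log n)$-bit messages per edge per round; weights representable with $O(\log n)$ bits. Standing assumption: every node knows the value of $\alpha$. *)

(* Defs.v *)
From mathcomp Require Import all_boot all_order all_algebra.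
From mathcomp Require Import reals exp.

Set Implicit Arguments.
Unset Strict Implicit.
Unset Printing Implicit Defensive.

Import Order.TTheory GRing.Theory Num.Theory.
Local Open Scope ring_scope.

Record sgraph (V : finType) := SGraph {
  adj :> rel V;
  adj_sym : symmetric adj;
  adj_irrefl : irreflexive adj }.

(* A cycle of a simple graph has at least three vertices; [:: x; y] is an
   [ucycle] of any symmetric relation with [r x y], hence the bound 2. *)
Definition is_forest (V : finType) (r : rel V) : Prop :=
  forall s : seq V, ucycle r s -> (size s <= 2)%N.

(* [f x y] is the index of the forest that contains the edge [xy]; its values
   on non-edges are irrelevant. *)
Definition forest_partition (V : finType) (e : rel V) (k : nat) : Prop :=
  exists f : V -> V -> nat,
    [/\ forall x y, f x y = f y x,
        forall x y, e x y -> (f x y < k)%N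
      & forall i, (i < k)%N -> is_forest [rel x y | e x y && (f x y == i)]].

Definition is_arboricity (V : finType) (e : rel V) (a : nat) : Prop :=
  forest_partition e a /\ forall b, forest_partition e b -> (a <= b)%N.

Definition independent (V : finType) (e : rel V) (X : {set V}) : bool :=
  [forall x in X, forall y in X, ~~ e x y].

Definition weight (R : realType) (V : finType) (w : V -> R) (X : {set V}) : R :=
  \sum_(v in X) w v.

(* The default 0 is the weight of the independent set [set0]. *)
Definition OPT (R : realType) (V : finType) (e : rel V) (w : V -> R) : R :=
  \big[Num.max/0]_(X : {set V} | independent e X) weight w X.

Definition is_approx (R : realType) (V : finType) (e : rel V) (w : V -> R)
    (q : R) (X : {set V}) : Prop :=
  independent e X /\ OPT e w <= q * weight w X.

(* [c] times log n bits, with the logarithm in base 2 rounded up *)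
Definition logbits (c n : nat) : nat := (c * up_log 2 n)%N.

(* [dec] is the convention that maps a bit string to the number it denotes. *)
Definition representable (R : realType) (dec : bitseq -> R) (b : nat) (x : R) :
    Prop :=
  exists2 s : bitseq, (size s <= b)%N & dec s = x.

(* A deterministic message-passing algorithm with unrestricted local
   computation. Initially a node knows the number [n] of nodes, the arboricity
   [alpha], its own identifier and weight, and its degree. It addresses its
   neighbours only through ports 0, 1, ..., deg - 1: [send s i] is the message
   for port [i], and [recv s l] is the new state once the [i]-th message of [l]
   has arrived through port [i]. The empty string stands for silence. A node
   terminates when [output] becomes [Some b], where [b] tells whether the node
   is in the computed set. *)
Record algorithm (R : realType) := Algorithm {
  state : Type;
  init : forall (n alpha ident : nat) (wt : R) (deg : nat), state;
  send : state -> nat -> bitseq;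
  recv : state -> seq bitseq -> state;
  output : state -> option bool }.

Section Execution.
Variables (R : realType) (A : algorithm R) (V : finType).
(* [ports v] lists the neighbours of [v] in the order of the ports of [v]. *)
Variables (ports : V -> seq V) (ident : V -> nat) (w : V -> R) (alpha : nat).

Definition config := V -> state A.

Definition start : config :=
  fun v => init A #|V| alpha (ident v) (w v) (size (ports v)).

Definition halted (s : state A) : bool := isSome (output s).

Definition msg (st : config) (u v : V) : bitseq :=
  if halted (st u) then [::] else send (st u) (index v (ports u)).

Definition round (st : config) : config := fun v =>
  if halted (st v) then st v
  else recv (st v) [seq msg st u v | u <- ports v].

Definition run (t : nat) : config := iter t round start.

Definition terminated (t : nat) : Prop := forall v, halted (run t v).

Definition computed_set (t : nat) : {set V} :=
  [set v | output (run t v) == Some true].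

Definition congest (b : nat) : Prop :=
  forall t u v, v \in ports u -> (size (msg (run t) u v) <= b)%N.

End Execution.

Definition port_numbering (V : finType) (e : rel V) (ports : V -> seq V) :
    Prop :=
  forall v, uniq (ports v) /\ ports v =i e v.

Definition valid_ids (V : finType) (b : nat) (ident : V -> nat) : Prop :=
  injective ident /\ forall v, (ident v < 2 ^ b)%N.

(* Main.v *)
Require Import Defs.
From mathcomp Require Import all_boot all_order all_algebra all_field.
From mathcomp Require Import boolp reals exp zify lra ring.

(* Peeling off, O(log n) times, the vertices with at most 4 alpha remaining
   neighbours gives every vertex a height; directing edges towards larger
   height (both ways between equal heights), every vertex has at most 4 alpha
   out-neighbours.  A set all of whose out-degrees are 0 is independent.

   A stage turns a set S with out-degrees less than D into a subset S' with
   out-degrees less than D/p and w(S) <= 8p w(S').  At random one would keep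
   each vertex with probability 1/(4p) and then discard the vertices with too
   many surviving out-neighbours.  The corresponding lower bound on the
   expected weight is a quadratic form in the probabilities, so it can be
   derandomized by conditional expectations, one colour class after the other,
   provided that the interactions inside a class are harmless.  A colouring
   with O(p^3) colours in which a vertex shares its colour with less than
   D/(4p) out-neighbours is obtained from the identifiers by O(log n)
   Reed-Solomon colour reductions, whose defects form a geometric sum.

   With p = O(alpha^(tau/3)) a constant number k of stages suffices; the loss is
   (8p)^k = O(alpha) and each stage takes O(p^3 + log n) rounds. *)

Set Implicit Arguments.
Unset Strict Implicit.
Unset Printing Implicit Defensive.

Import Order.TTheory GRing.Theory Num.Theory.

(** * Fixed-width binary encodings *)

Fixpoint nat_bits (b x : nat) : bitseq :=
  if b is b'.+1 then odd x :: nat_bits b' x./2 else [::].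

Fixpoint bits_nat (s : bitseq) : nat :=
  if s is a :: s' then a + (bits_nat s').*2 else 0.

Lemma size_nat_bits b x : size (nat_bits b x) = b.
Proof. by elim: b x => //= b IH x; rewrite IH. Qed.

Lemma nat_bitsK b x : x < 2 ^ b -> bits_nat (nat_bits b x) = x.
Proof.
elim: b x => [|b IH] x /=; first by case: x.
rewrite expnS mul2n => xb; rewrite IH ?odd_double_half //.
by rewrite ltn_half_double.
Qed.

(** * Sparsity of graphs of small arboricity *)

Section Forest.
Variables (V : finType) (r : rel V).
Hypotheses (r_sym : symmetric r) (r_irr : irreflexive r) (r_forest : is_forest r).

(** Otherwise every vertex of [S] has two neighbours in [S], and a simple path could be prolonged
    beyond [#|V|] vertices: a return to the path would close a cycle. *)
Lemma forest_leaf (S : {set V}) : S != set0 ->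
  exists2 v, v \in S & \sum_(u in S) r v u <= 1.
Proof.
move=> /set0Pn[v0 v0S]; case: (pselect (exists2 v, v \in S & \sum_(u in S) r v u <= 1)) => // noleaf.
exfalso.
have two v : v \in S -> exists a b, [/\ a \in S, b \in S, r v a, r v b & a != b].
  move=> vS.
  have : 1 < #|[set u in S | r v u]|.
    rewrite ltnNge; apply/negP => small; apply: noleaf; exists v => //.
    rewrite (leq_trans _ small) // -sum1_card big_mkcond /= [leqRHS]big_mkcond /=.
    by apply: leq_sum => u _; rewrite inE; case: (u \in S) => //=; case: (r v u).
  move=> /card_gt1P[a [b []]]; rewrite !inE => /andP[aS ra] /andP[bS rb] ab.
  by exists a, b.
have long n : exists x s, [/\ path r x s, uniq (x :: s), {subset x :: s <= S} & size s = n].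
  elim: n => [|n [x [s [xs us sS sz]]]].
    by exists v0, [::]; split => // y; rewrite inE => /eqP->.
  have xS : x \in S by apply: sS; rewrite mem_head.
  (* Avoiding the previous vertex of the path ensures that a cycle closed here has at least three
     vertices. *)
  have [y [yS rxy yh]] : exists y, [/\ y \in S, r x y & y != head x s].
    have [a [b [aS bS ra rb ab]]] := two x xS.
    case: (eqVneq a (head x s)) => [ah|]; last by exists a.
    by exists b; split => //; rewrite -ah eq_sym.
  case: (boolP (y \in x :: s)) => [|ys]; last first.
    exists y, (x :: s); split => //=.
    - by rewrite r_sym rxy.
    - by rewrite ys.
    - by move=> z; rewrite inE => /orP[/eqP->//|/sS].
    - by rewrite sz.
  rewrite inE => /orP[/eqP yx|ys]; first by rewrite yx r_irr in rxy.
  exfalso; move: ys yh xs us; case/splitPr => s1 s2.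
  case: s1 => [|a s1]; first by rewrite /= eqxx.
  move=> _ xs us.
  suff /r_forest : ucycle r (x :: rcons (a :: s1) y) by rewrite /= size_rcons.
  apply/andP; split; rewrite /cycle.
    move: xs; rewrite -cat_rcons cat_path => /andP[xs _].
    by rewrite rcons_path xs last_rcons r_sym.
  move: us; rewrite -cat_rcons -cat_cons cat_uniq => /andP[+ _].
  by rewrite /= rcons_uniq.
have [x [s [_ us _ sz]]] := long #|V|.
by have := uniq_leq_size us (fun y _ => mem_enum V y); rewrite -cardE /= sz ltnn.
Qed.

(** Removing a leaf loses at most one edge, counted here in both directions. *)
Lemma forest_sparse (S : {set V}) : \sum_(v in S) \sum_(u in S) r v u <= 2 * #|S|.
Proof.
elim: {S}#|S| {-2}S (erefl #|S|) => [|n IH] S cS.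
  by move/eqP: cS; rewrite cards_eq0 => /eqP->; rewrite big_set0.
have [|v vS leaf] := forest_leaf (S := S); first by rewrite -cards_eq0 cS.
have cS' : #|S :\ v| = n by move: cS; rewrite (cardsD1 v) vS => -[].
have H := IH _ cS'; move: leaf; rewrite (big_setD1 v vS) /= r_irr add0n => leaf.
rewrite cS (big_setD1 v vS) /= [\sum_(u in S) _](big_setD1 v vS) /= r_irr add0n.
under [X in _ + X]eq_bigr => u _ do rewrite (big_setD1 v vS) /= r_sym.
rewrite big_split /=; rewrite cS' in H.  lia.
Qed.

End Forest.

Lemma forest_partition_sparse (V : finType) (G : sgraph V) k (S : {set V}) :
  forest_partition G k -> \sum_(v in S) \sum_(u in S) G v u <= 2 * k * #|S|.
Proof.
case=> f [fC fk ff].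
apply: (@leq_trans (\sum_(i < k) \sum_(v in S) \sum_(u in S) (G v u && (f v u == i)))).
  rewrite [leqRHS]exchange_big /=; apply: leq_sum => v _.
  rewrite [leqRHS]exchange_big /=; apply: leq_sum => u _.
  case Gvu: (G v u) => //=.
  by rewrite (bigD1 (Ordinal (fk _ _ Gvu))) //= eqxx.
rewrite -mulnA mulnCA -[k in k * _]card_ord -sum_nat_const; apply: leq_sum => i _.
apply: (forest_sparse (r := [rel x y | G x y && (f x y == i)])); last exact: ff.
- by move=> x y /=; rewrite adj_sym fC.
- by move=> x /=; rewrite adj_irrefl.
Qed.

(** Markov's inequality: the degrees inside [S] add up to at most [2 * k * #|S|]. *)
Lemma few_high_degree (V : finType) (G : sgraph V) k (S : {set V}) :
  0 < k -> forest_partition G k ->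
  2 * #|[set v in S | 4 * k < #|[set u in S | G v u]|]| <= #|S|.
Proof.
move=> k0 /forest_partition_sparse - /(_ S) sparse; set H := [set v in S | _].
rewrite -(leq_pmul2l (_ : 0 < 2 * k)) ?muln_gt0 ?k0 //; apply: leq_trans sparse.
apply: (@leq_trans (\sum_(v in H) \sum_(u in S) G v u)).
  have -> : 2 * k * (2 * #|H|) = #|H| * (4 * k) by lia.
  rewrite -sum_nat_const.
  apply: leq_sum => v; rewrite inE => /andP[_ /ltnW] /leq_trans; apply.
  rewrite -sum1_card big_mkcond /= [leqRHS]big_mkcond /=.
  by apply: leq_sum => u _; rewrite inE; case: (u \in S) => //=; case: (G v u).
rewrite big_mkcond [leqRHS]big_mkcond; apply: leq_sum => v _.
by rewrite inE; case: (v \in S) => //=; case: ifP.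
Qed.

Lemma arboricity0 (V : finType) (G : sgraph V) : is_arboricity G 0 -> forall x y, ~~ G x y.
Proof. by case=> [[f [_ f0 _]] _] x y; apply/negP => /f0. Qed.

Lemma arboricity_gt0 (V : finType) (G : sgraph V) k :
  is_arboricity G k -> 0 < k -> 1 < #|V|.
Proof.
case=> _ min k0; rewrite ltnNge; apply/negP => /fintype_le1P V1.
suff /min : forest_partition G 0 by rewrite leqNgt k0.
exists (fun _ _ => 0); split=> // x y.
by rewrite (V1 y x) adj_irrefl.
Qed.

(** * A code of relative distance close to one *)

(* The Reed-Solomon code of degree at most 2: distinct quadratic polynomials over
   the field with [2 ^ m.+1] elements agree in at most 2 points.  Symbols and positions are
   numbered along the enumeration of the field. *)
Section Code.
Variable m : nat.

Definition code_field : finFieldType := s2val (pPrimePowerField (isT : prime 2) (ltn0Sn m)).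
Local Notation F := code_field.

Lemma card_code_field : #|F| = 2 ^ m.+1.
Proof. by rewrite /code_field; case: pPrimePowerField. Qed.

Definition code_poly (a : nat) : {poly F} :=
  let: (x, y, z) := nth (0, 0, 0)%R (enum {: F * F * F}) a in Poly [:: x; y; z].

Definition code (a i : nat) : nat := index (code_poly a).[nth 0%R (enum F) i]%R (enum F).

Lemma code_lt a i : code a i < 2 ^ m.+1.
Proof. by rewrite -card_code_field cardE index_mem mem_enum. Qed.

Lemma code_poly_inj a b : a < 2 ^ (3 * m.+1) -> b < 2 ^ (3 * m.+1) ->
  code_poly a = code_poly b -> a = b.
Proof.
have sz : size (enum {: F * F * F}) = 2 ^ (3 * m.+1).
  by rewrite -cardE !card_prod card_code_field -!expnD; congr (2 ^ _); lia.
rewrite -sz => aK bK ab.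
apply/eqP; rewrite -(nth_uniq (0, 0, 0)%R aK bK (enum_uniq _)); apply/eqP.
move: ab; rewrite /code_poly; case: nth => [[x y] z]; case: nth => [[x' y'] z'] /polyP eqP.
have := eqP 0; have := eqP 1; have := eqP 2; rewrite !coef_Poly /= => -> -> ->.
by [].
Qed.

Lemma code_distance a b : a < 2 ^ (3 * m.+1) -> b < 2 ^ (3 * m.+1) -> a != b ->
  count (fun i => code a i == code b i) (iota 0 (2 ^ m.+1)) <= 2.
Proof.
move=> aK bK ab.
have sz : size (enum F) = 2 ^ m.+1 by rewrite -cardE card_code_field.
pose P := (code_poly a - code_poly b)%R.
have P0 : P != 0%R.
  by rewrite subr_eq0; apply: contra_neq ab => /(code_poly_inj aK bK).
have sP : size P <= 3.
  have s3 c : size (code_poly c) <= 3.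
    by rewrite /code_poly; case: nth => [[x y] z]; apply: size_Poly.
  by rewrite (leq_trans (size_polyD _ _)) // size_polyN geq_max !s3.
rewrite -size_filter -(size_map (nth 0%R (enum F))).
rewrite -ltnS (leq_trans _ sP) // max_poly_roots //.
  apply/allP => x /mapP[i]; rewrite mem_filter mem_iota add0n /= => /andP[eqi il ->].
  have E : (code_poly a).[(enum F)`_i]%R = (code_poly b).[(enum F)`_i]%R.
    rewrite -[LHS](nth_index 0%R (mem_enum F _)) -[RHS](nth_index 0%R (mem_enum F _)).
    by congr nth; apply/eqP.
  by rewrite /root hornerD hornerN E subrr.
rewrite map_inj_in_uniq ?filter_uniq ?iota_uniq // => i j.
rewrite !mem_filter !mem_iota !add0n /= => /andP[_ il] /andP[_ jl] /eqP.
by rewrite nth_uniq ?sz ?enum_uniq // => /eqP.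
Qed.

(** Occurrences of [a] itself collide at every point; they belong to the old defect. *)
Definition collisions (a : nat) (s : seq nat) (i : nat) : nat :=
  count (fun b => (b != a) && (code a i == code b i)) s.

Definition good_point (a : nat) (s : seq nat) (i : nat) : bool :=
  collisions a s i * 2 ^ m.+1 <= 2 * size s.

Definition pick_point (a : nat) (s : seq nat) : nat :=
  find (good_point a s) (iota 0 (2 ^ m.+1)).

Lemma pick_point_le a s : pick_point a s <= 2 ^ m.+1.
Proof. by rewrite -[leqRHS](size_iota 0) find_size. Qed.

(* Averaging: the collisions over all points number at most [2 * size s]. *)
Lemma pick_point_good a s :
  a < 2 ^ (3 * m.+1) -> all (fun b => b < 2 ^ (3 * m.+1)) s ->
  pick_point a s < 2 ^ m.+1 /\ good_point a s (pick_point a s).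
Proof.
move=> aK /allP sK.
have hasP : has (good_point a s) (iota 0 (2 ^ m.+1)).
  apply/negPn/negP => /hasPn bad.
  have tot : \sum_(i <- iota 0 (2 ^ m.+1)) collisions a s i <= 2 * size s.
    under eq_bigr => i _ do rewrite /collisions -sum1_count big_mkcond.
    rewrite exchange_big /= -iter_addn_0 -count_predT -big_const_seq.
    rewrite big_seq [leqRHS]big_seq; apply: leq_sum => b bs.
    rewrite -big_mkcond sum1_count; case: (eqVneq b a) => [_|ba] /=.
      by rewrite count_pred0.
    by apply: code_distance => //; [apply: sK|rewrite eq_sym].
  have : \sum_(i <- iota 0 (2 ^ m.+1)) (2 * size s).+1 <=
         \sum_(i <- iota 0 (2 ^ m.+1)) collisions a s i * 2 ^ m.+1.
    rewrite big_seq [leqRHS]big_seq; apply: leq_sum => i ii.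
    by rewrite ltnNge; apply: bad.
  rewrite -big_distrl /= big_const_seq count_predT size_iota iter_addn_0.
  have := expn_gt0 2 m.+1; nia.
split; first by rewrite /pick_point -[ltnRHS](size_iota 0) -has_find.
have := nth_find 0 hasP; rewrite nth_iota // -[ltnRHS](size_iota 0) -has_find //.
Qed.

End Code.

(** * Synchronous programs *)

(* Every node broadcasts its whole [node] record in each round.  [mark] is 0 for
   a discarded node, 1 for a candidate and 2 for a node that is still undecided in the current
   stage; [wstr] is a bit string denoting the weight. *)
Record node := Node {
  height : nat;
  nid : nat;
  color : nat;
  mark : nat;
  wstr : bitseq }.

Definition instr := node -> seq node -> node.

Definition peel (d i : nat) : instr := fun q N =>
  if (height q == i) && (d < count (fun q' => height q' == i) N)
  then Node i.+1 (nid q) (color q) (mark q) (wstr q) else q.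

(** The identifiers serve as a first colouring, which has no defect. *)
Definition restart : instr := fun q _ =>
  Node (height q) (nid q) (nid q) (if mark q == 0 then 0 else 2) (wstr q).

Definition outs (q : node) (N : seq node) : seq node :=
  [seq q' <- N | (height q <= height q') && (mark q' != 0)].

(** The new colour is the pair of evaluation point and code symbol, in base [2 ^ m.+1]. *)
Definition reduce (m : nat) : instr := fun q N =>
  let i := pick_point m (color q) [seq color q' | q' <- outs q N] in
  Node (height q) (nid q) (i * 2 ^ m.+1 + code m (color q) i) (mark q) (wstr q).

(** The exponent of the field size falls from [e + s] to [e.+1], by one per round. *)
Fixpoint reductions (e s : nat) : seq instr :=
  if s is s'.+1 then reduce (e + s') :: reductions e s' else [::].

Definition discard (p D : nat) : instr := fun q N =>
  Node (height q) (nid q) (color q)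
    ((mark q != 0) && (2 * p * count (fun q' => color q' != color q) (outs q N) < D))
    (wstr q).

Section Decide.
Variables (R : realType) (dec : bitseq -> R) (lam rho : R).
Local Open Scope ring_scope.

Definition mark_prob (k : nat) : R := if k == 0%N then 0 else if k == 1%N then 1 else rho.

(** The partial derivative of [potential] in the probability of [q]: its weight, less its own
    penalties and those it inflicts on nodes having it as an out-neighbour. *)
Definition gain (q : node) (N : seq node) : R :=
  dec (wstr q) *
    (1 - lam * \sum_(q' <- N | (height q <= height q')%N && (color q' != color q))
                  mark_prob (mark q'))
  - lam * \sum_(q' <- N | (height q' <= height q)%N && (color q' != color q))
             dec (wstr q') * mark_prob (mark q').

Definition decide (c : nat) : instr := fun q N =>
  if (mark q == 2%N) && (color q == c)
  then Node (height q) (nid q) (color q) (nat_of_bool (0 <= gain q N)%R) (wstr q) else q.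

End Decide.

(** The probability [1 / (4 p)] limits the expected penalty of an undecided node to 1/2; the rate
    [2 p / D] makes the penalty factor of a node with [D / (2 p)] bichromatic out-neighbours
    vanish. *)
Definition stage (R : realType) (dec : bitseq -> R) (p D e s : nat) : seq instr :=
  restart :: reductions e s ++
  [seq decide dec ((2 * p)%:R / D%:R) (4 * p)%:R^-1 c | c <- iota 0 (2 ^ (3 * e))]%R ++
  [:: discard p D].

Section Exec.
Variables (V : finType) (ports : V -> seq V).

Definition step (I : instr) (X : V -> node) : V -> node :=
  fun v => I (X v) [seq X u | u <- ports v].

Definition exec (prog : seq instr) (X : V -> node) : V -> node :=
  foldl (fun X I => step I X) X prog.

Lemma exec_cat prog1 prog2 X : exec (prog1 ++ prog2) X = exec prog2 (exec prog1 X).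
Proof. exact: foldl_cat. Qed.

End Exec.

(** * Monotonicity of a quadratic form *)

Local Open Scope ring_scope.

(** Changed coordinates do not interact, so the increment has no second-order part and splits into
    one first-order term per coordinate. *)
Lemma quadratic_increase (R : realType) (V : finType) (w : V -> R) (a : V -> V -> R)
    (lam : R) (Y Y' : V -> R) (Phi := fun Z : V -> R =>
      \sum_v w v * Z v - lam * \sum_v \sum_u a v u * Z v * Z u) :
  (forall v u, a v u * (Y' v - Y v) * (Y' u - Y u) = 0) ->
  (forall v, 0 <= (Y' v - Y v) *
     (w v - lam * (\sum_u a v u * Y u) - lam * (\sum_u a u v * Y u))) ->
  Phi Y <= Phi Y'.
Proof.
move=> indep incr; rewrite -subr_ge0.
suff -> : Phi Y' - Phi Y = \sum_v (Y' v - Y v) *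
     (w v - lam * (\sum_u a v u * Y u) - lam * (\sum_u a u v * Y u)).
  by apply: sumr_ge0 => v _.
pose Dl v := Y' v - Y v.
have E : \sum_v \sum_u a v u * Y' v * Y' u = \sum_v \sum_u a v u * Y v * Y u +
    \sum_v Dl v * (\sum_u a v u * Y u) + \sum_v Dl v * (\sum_u a u v * Y u).
  under [X in _ = _ + _ + X]eq_bigr => v _ do rewrite mulr_sumr.
  rewrite [X in _ = _ + _ + X]exchange_big /= -!big_split; apply: eq_bigr => v _ /=.
  rewrite mulr_sumr -!big_split; apply: eq_bigr => u _ /=.
  by rewrite -[RHS]addr0 -(indep v u) /Dl; ring.
have -> : \sum_v (Y' v - Y v) *
     (w v - lam * (\sum_u a v u * Y u) - lam * (\sum_u a u v * Y u)) =
  (\sum_v w v * Y' v - \sum_v w v * Y v) - lam * \sum_v Dl v * (\sum_u a v u * Y u)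
    - lam * \sum_v Dl v * (\sum_u a u v * Y u).
  by rewrite !mulr_sumr -!sumrB; apply: eq_bigr => v _; rewrite /Dl; ring.
by rewrite /Phi E; ring.
Qed.

Local Close Scope ring_scope.

(** * Defective colourings and their reduction *)

Section Dynamics.
Variables (V : finType) (G : sgraph V) (ports : V -> seq V).
Hypothesis ports_G : port_numbering G ports.
Variables (h idn : V -> nat) (sw : V -> bitseq).
Implicit Types X : V -> node.

Lemma count_ports (P : pred node) X v :
  count P [seq X u | u <- ports v] = #|[set u | G v u && P (X u)]|.
Proof.
have [up mp] := ports_G v.
rewrite count_map -size_filter -(card_uniqP _) ?filter_uniq //.
by apply: eq_card => u; rewrite !inE mem_filter /= mp andbC.
Qed.

Lemma sum_ports (R : realType) (P : pred node) (F : node -> R) X v :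
  (\sum_(q <- [seq X u | u <- ports v] | P q) F q = \sum_(u | G v u && P (X u)) F (X u))%R.
Proof.
have [up mp] := ports_G v.
rewrite big_map -big_filter big_uniq ?filter_uniq //=.
by apply: eq_bigl => u; rewrite mem_filter mp andbC.
Qed.

Definition static X : Prop :=
  forall v, [/\ height (X v) = h v, nid (X v) = idn v & wstr (X v) = sw v].

(* Neighbours of equal height are joined in both directions. *)
Definition uparc (v u : V) : bool := G v u && (h v <= h u).

Definition outset X v : {set V} := [set u | uparc v u && (mark (X u) != 0)].

Definition mono X v : {set V} := [set u in outset X v | color (X u) == color (X v)].

Lemma count_outs (P : pred node) X v : static X ->
  count P (outs (X v) [seq X u | u <- ports v]) = #|[set u in outset X v | P (X u)]|.
Proof.
move=> sX; rewrite count_filter count_ports; apply: eq_card => u.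
have [hv _ _] := sX v; have [hu _ _] := sX u.
by rewrite !inE /= hv hu /uparc; case: (G v u) => //=; rewrite andbC.
Qed.

(** An out-neighbour sharing the new colour of [v] either shared the old one or collides with [v] at
    the point picked by [v]; the choice of that point limits the latter. *)
Lemma reduce_spec m X (X' := step ports (reduce m) X) : static X ->
  (forall v, color (X v) < 2 ^ (3 * m.+1)) ->
  [/\ static X', forall v, mark (X' v) = mark (X v),
      forall v, color (X' v) < 2 ^ (2 * m.+1)
    & forall v, #|mono X' v| * 2 ^ m.+1 <= #|mono X v| * 2 ^ m.+1 + 2 * #|outset X v|].
Proof.
move=> sX cX; pose cs v := [seq color q | q <- outs (X v) [seq X u | u <- ports v]].
pose i v := pick_point m (color (X v)) (cs v).
have good v : i v < 2 ^ m.+1 /\ good_point m (color (X v)) (cs v) (i v).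
  apply: pick_point_good => //; rewrite all_map all_filter all_map.
  by apply/allP => u _ /=; apply/implyP.
have cX' v : color (X' v) = i v * 2 ^ m.+1 + code m (color (X v)) (i v) by [].
split=> // v.
  rewrite cX' mul2n -addnn expnD; have [iv _] := good v.
  have := code_lt m (color (X v)) (i v); nia.
have [_] := good v; rewrite /good_point /collisions size_map.
rewrite -[size _]count_predT count_map !count_outs // => coll.
have -> : #|outset X v| = #|[set u in outset X v | predT (X u)]|.
  by apply: eq_card => u; rewrite !inE andbT.
set C := [set u in outset X v | preim _ _ _] in coll.
have sub : mono X' v \subset mono X v :|: C.
  apply/subsetP => u; rewrite !inE -andbA => /and3P[au mu cc].
  have -> : uparc v u = true := au.
  have -> /= : mark (X u) != 0 := mu.
  case: eqVneq => //= _.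
  (* Remainder and quotient recover the symbol and the point. *)
  have : color (X' u) %% 2 ^ m.+1 = color (X' v) %% 2 ^ m.+1 by rewrite (eqP cc).
  have : color (X' u) %/ 2 ^ m.+1 = color (X' v) %/ 2 ^ m.+1 by rewrite (eqP cc).
  rewrite !cX' !divnMDl ?expn_gt0 // !divn_small ?code_lt // !addn0 => ->.
  by rewrite !modnMDl !modn_small ?code_lt // => ->.
rewrite (leq_trans (leq_mul (subset_leq_card sub) (leqnn _))) //.
rewrite (leq_trans (leq_mul (leq_card_setU _ _) (leqnn _))) //.
by rewrite mulnDl leq_add2l.
Qed.

Lemma outset_mark X X' : (forall v, mark (X' v) = mark (X v)) ->
  forall v, outset X' v = outset X v.
Proof. by move=> mX v; apply/setP => u; rewrite !inE mX. Qed.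

(* The defects form a geometric sum: the one at field size [2 ^ m] is twice
   the one at field size [2 ^ m.+1]. *)
Lemma reductions_spec e s X (X' := exec ports (reductions e s) X) : 2 <= e -> static X ->
  (forall v, color (X v) < 2 ^ (3 * (e + s))) ->
  (forall v, #|mono X v| * 2 ^ (e + s) <= 2 * #|outset X v|) ->
  [/\ static X', forall v, mark (X' v) = mark (X v),
      forall v, color (X' v) < 2 ^ (3 * e)
    & forall v, #|mono X' v| * 2 ^ e <= 2 * #|outset X' v|].
Proof.
move=> e2; rewrite /X' {X'}; elim: s X => [|s IH] X sX cX mX /=.
  by rewrite addn0 in cX mX; split.
rewrite addnS in cX mX.
have [sX1 kX1 cX1 mX1] := reduce_spec sX cX.
have [||sX' kX' cX' mX'] := IH _ sX1.
(* As [2 <= e], [2 * (e + s).+1 <= 3 * (e + s)]: the next, smaller field still admits the new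
   colours. *)
- move=> v; apply: leq_trans (cX1 v) _; rewrite leq_exp2l //; lia.
- move=> v; rewrite (outset_mark kX1); have := mX v; have := mX1 v; rewrite expnS; nia.
by split=> // v; rewrite kX' kX1.
Qed.

End Dynamics.

(** * Derandomized thinning of a sparse set *)

Section Sweep.
Variables (R : realType) (dec : bitseq -> R) (lam rho : R).
Hypotheses (rho_ge0 : (0 <= rho)%R) (rho_le1 : (rho <= 1)%R).
Variables (V : finType) (G : sgraph V) (ports : V -> seq V).
Hypothesis ports_G : port_numbering G ports.
Variables (h idn : V -> nat) (sw : V -> bitseq).
Implicit Types X : V -> node.
Local Notation static := (static h idn sw).
Local Notation uparc := (uparc G h).
Local Open Scope ring_scope.

Definition prob X v : R := mark_prob rho (mark (X v)).

(** The expected weight of the candidates under independent choices with probabilities [prob], after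
    a penalty of [lam] times the weight for each bichromatic out-neighbour. *)
Definition potential X : R :=
  \sum_v dec (sw v) * prob X v *
    (1 - lam * \sum_(u | uparc v u && (color (X u) != color (X v))) prob X u).

(** The coefficients of the quadratic form [potential] vanish inside a colour class, so all
    undecided nodes of colour [c] can move at once, each to the end of the unit interval indicated
    by the sign of its [gain]. *)
Lemma decide_spec c X (X' := step ports (decide dec lam rho c) X) : static X ->
  [/\ static X', forall v, color (X' v) = color (X v),
      forall v, mark (X' v) =
        if (mark (X v) == 2%N) && (color (X v) == c)
        then nat_of_bool (0 <= gain dec lam rho (X v) [seq X u | u <- ports v])
        else mark (X v)
    & potential X <= potential X'].
Proof.
move=> sX; pose chg v := (mark (X v) == 2%N) && (color (X v) == c).
have E v : X' v = if chg v then
    Node (height (X v)) (nid (X v)) (color (X v))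
      (nat_of_bool (0 <= gain dec lam rho (X v) [seq X u | u <- ports v])) (wstr (X v))
    else X v by [].
have cX' v : color (X' v) = color (X v) by rewrite E; case: ifP.
have mX' v : mark (X' v) = if chg v
    then nat_of_bool (0 <= gain dec lam rho (X v) [seq X u | u <- ports v]) else mark (X v).
  by rewrite E; case: ifP.
split=> //; first by move=> v; rewrite E; case: ifP => _; exact: sX.
pose a v u : R := dec (sw v) * (uparc v u && (color (X u) != color (X v)))%:R.
have PE Z : (forall v, color (Z v) = color (X v)) -> potential Z =
    \sum_v dec (sw v) * prob Z v - lam * \sum_v \sum_u a v u * prob Z v * prob Z u.
  move=> cZ; rewrite mulr_sumr -sumrB; apply: eq_bigr => v _.
  rewrite mulrBr mulr1 mulrCA; congr (_ - lam * _).
  rewrite mulr_sumr big_mkcond; apply: eq_bigr => u _ /=; rewrite /a !cZ.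
  by case: (_ && _); rewrite /=; ring.
rewrite !PE //; apply: quadratic_increase.
  move=> v u; rewrite /prob !mX'; case: ifP => [/andP[_ /eqP cv]|_]; last by ring.
  case: ifP => [/andP[_ /eqP cu]|_]; last by ring.
  by rewrite /a cv cu eqxx andbF /= mulr0 !mul0r.
move=> v.
have -> : dec (sw v) - lam * (\sum_u a v u * prob X u) - lam * (\sum_u a u v * prob X u) =
    gain dec lam rho (X v) [seq X u | u <- ports v].
  have [hv _ wv] := sX v.
  rewrite /gain wv mulrBr mulr1 (sum_ports ports_G) (sum_ports ports_G) mulrCA.
  congr (_ - lam * _ - lam * _).
    rewrite mulr_sumr big_mkcond [RHS]big_mkcond /=; apply: eq_bigr => u _.
    have [hu _ _] := sX u; rewrite hv hu /a /uparc -andbA.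
    by case: (_ && _); rewrite /prob /=; ring.
  rewrite [RHS]big_mkcond /=; apply: eq_bigr => u _.
  have [hu _ wu] := sX u; rewrite hv hu wu /a /uparc -andbA adj_sym [color (X v) == _]eq_sym.
  by case: (_ && _); rewrite /prob /=; ring.
rewrite /prob mX'; case: ifP => [/andP[/eqP-> _]|_]; last by rewrite subrr mul0r.
rewrite /mark_prob /=; set g := gain _ _ _ _ _.
case: (leP 0 g) => g0 /=; first by apply: mulr_ge0 => //; rewrite subr_ge0.
by apply: mulr_le0; [rewrite sub0r oppr_le0|exact: ltW].
Qed.

Lemma sweep_spec (cs : seq nat) X (X' := exec ports [seq decide dec lam rho c | c <- cs] X) :
  static X -> (forall v, (mark (X v) <= 2)%N) ->
  [/\ static X', forall v, color (X' v) = color (X v),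
      forall v, (mark (X' v) <= mark (X v))%N,
      forall v, color (X v) \in cs -> (mark (X' v) <= 1)%N
    & potential X <= potential X'].
Proof.
rewrite /X' {X'}; elim: cs X => [|c cs IH] X sX mX /=; first by split.
have [sX1 cX1 mX1 pX1] := decide_spec c sX.
have leX1 v : (mark (step ports (decide dec lam rho c) X v) <= mark (X v))%N.
  by rewrite mX1; case: ifP => // /andP[/eqP-> _]; case: leP.
have [|sX' cX' aX' mX' pX'] := IH _ sX1.
  by move=> v; apply: leq_trans (leX1 v) _.
split=> [//|v|v|v|].
- by rewrite cX' cX1.
- exact: leq_trans (aX' v) (leX1 v).
- have := mX' v; rewrite cX1 inE => mX'v /orP[/eqP cv|//].
  apply: leq_trans (aX' v) _; rewrite mX1 cv eqxx andbT.
  case: (ltngtP (mark (X v)) 2) (mX v) => // _ _.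
  by case: leP.
- exact: le_trans pX1 pX'.
Qed.

End Sweep.

(** * One stage of thinning *)

Section Stage.
Variables (R : realType) (dec : bitseq -> R) (V : finType) (G : sgraph V) (ports : V -> seq V).
Hypothesis ports_G : port_numbering G ports.
Variables (h idn : V -> nat) (sw : V -> bitseq).
Hypothesis sw_ge0 : (forall v, 0 <= dec (sw v))%R.
Variables (p D e s : nat).
Hypotheses (p_gt0 : 0 < p) (D_gt0 : 0 < D) (pe : 8 * p <= 2 ^ e) (e_ge2 : 2 <= e).
Hypotheses (idn_inj : injective idn) (idn_lt : forall v, idn v < 2 ^ (3 * (e + s))).
Implicit Types X : V -> node.
Local Notation static := (static h idn sw).
Local Notation uparc := (uparc G h).
Local Notation outset := (outset G h).
Local Notation mono := (mono G h).

Let lam : R := ((2 * p)%:R / D%:R)%R.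
Let rho : R := ((4 * p)%:R^-1)%R.

Local Open Scope ring_scope.

Definition bichromatic X v := [set u in outset X v | color (X u) != color (X v)].

Lemma sum_prob_bichromatic X (y : R) v :
  (forall u, prob rho X u = if mark (X u) == 0%N then 0 else y) ->
  \sum_(u | uparc v u && (color (X u) != color (X v))) prob rho X u =
  y * #|bichromatic X v|%:R.
Proof.
move=> Xy; rewrite -sum1_card natr_sum mulr_sumr big_mkcond [RHS]big_mkcond /=.
apply: eq_bigr => u _; rewrite !inE Xy mulr1 -andbA.
by case: (uparc v u); case: (mark (X u) == 0%N); case: (color (X u) == color (X v)).
Qed.

(** Each undecided node contributes at least [rho / 2 = 1 / (8 p)] times its weight. *)
Lemma potential_undecided X :
  (forall v, mark (X v) \in [:: 0; 2]%N) ->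
  (forall v, mark (X v) != 0%N -> (#|outset X v| < D)%N) ->
  \sum_(v | mark (X v) != 0%N) dec (sw v) <= (8 * p)%:R * potential dec lam rho G h sw X.
Proof.
move=> mX dX.
have PX u : prob rho X u = if mark (X u) == 0%N then 0 else rho.
  by rewrite /prob /mark_prob; have := mX u; rewrite !inE => /orP[] /eqP->.
rewrite /potential mulr_sumr big_mkcond /=; apply: ler_sum => v _.
rewrite (sum_prob_bichromatic _ PX) PX; case: eqVneq => mv /=; first by rewrite mulr0 mul0r mulr0.
have bD : (#|bichromatic X v|%:R : R) <= D%:R.
  rewrite ler_nat (leq_trans _ (ltnW (dX v mv))) // subset_leq_card //.
  by apply/subsetP => u; rewrite inE => /andP[].
have p0 : (0 : R) < p%:R by rewrite ltr0n.
have D0 : (0 : R) < D%:R by rewrite ltr0n.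
have -> : (8 * p)%:R * (dec (sw v) * rho * (1 - lam * (rho * #|bichromatic X v|%:R))) =
  dec (sw v) * (2 - #|bichromatic X v|%:R / D%:R).
  rewrite /rho /lam !natrM; field.
  by rewrite !gt_eqF.
rewrite -[leLHS]mulr1 ler_wpM2l //.
have : #|bichromatic X v|%:R / D%:R <= 1 :> R by rewrite ler_pdivrMr ?mul1r.
lra.
Qed.

(** A candidate with at least [D / (2 p)] bichromatic out-neighbours contributes at most 0, any
    other at most its weight. *)
Lemma potential_decided X :
  (forall v, (mark (X v) <= 1)%N) ->
  potential dec lam rho G h sw X <=
  \sum_(v | (mark (X v) != 0%N) && (2 * p * #|bichromatic X v| < D)%N) dec (sw v).
Proof.
move=> mX.
have PX u : prob rho X u = if mark (X u) == 0%N then 0 else 1.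
  by rewrite /prob /mark_prob; case: (mark (X u)) (mX u) => [|[]].
rewrite /potential [leRHS]big_mkcond /=; apply: ler_sum => v _.
rewrite (sum_prob_bichromatic _ PX) PX; case: eqVneq => mv /=; first by rewrite mulr0 mul0r.
rewrite mulr1 mul1r.
have D0 : (0 : R) < D%:R by rewrite ltr0n.
have -> : lam * #|bichromatic X v|%:R = (2 * p * #|bichromatic X v|)%:R / D%:R.
  by rewrite /lam mulrAC -natrM.
case: ltnP => bD.
  by rewrite ler_piMr // gerBl divr_ge0.
by rewrite mulr_ge0_le0 // subr_le0 ler_pdivlMr // mul1r ler_nat.
Qed.

(** A survivor has fewer than [D / (2 p)] out-neighbours of other colours, by [discard], and fewer
    than [D / (4 p)] of its own, since [8 * p <= 2 ^ e]; together this is below [D / p]. The weights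
    before and after are compared through [potential]. *)
Lemma stage_spec X (X' := exec ports (stage dec p D e s) X) :
  static X -> (forall v, (mark (X v) <= 1)%N) ->
  (forall v, mark (X v) != 0%N -> (#|outset X v| < D)%N) ->
  [/\ static X', forall v, (mark (X' v) <= 1)%N,
      forall v, mark (X' v) != 0%N -> (p * #|outset X' v| < D)%N
    & \sum_(v | mark (X v) != 0%N) dec (sw v) <=
      (8 * p)%:R * \sum_(v | mark (X' v) != 0%N) dec (sw v)].
Proof.
move=> sX mX dX; rewrite /X' /stage /= !exec_cat.
set X1 := step ports restart X.
have sX1 : static X1 by move=> v; apply: sX.
have aX1 v : (mark (X1 v) != 0%N) = (mark (X v) != 0%N).
  by rewrite /X1 /step /=; case: (mark (X v)).
have kX1 v : mark (X1 v) \in [:: 0; 2]%N by rewrite /X1 /step /=; case: (mark (X v)).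
have cX1 v : color (X1 v) = idn v by have [_ <- _] := sX v.
have oX1 v : outset X1 v = outset X v by apply/setP => u; rewrite !inE aX1.
have mono1 v : mono X1 v = set0.
  apply/setP => u; rewrite !inE !cX1 /uparc (inj_eq idn_inj).
  by case: (eqVneq u v) => [->|]; rewrite ?adj_irrefl ?andbF.
have [v|v|sX2 kX2 cX2 defX2] := reductions_spec ports_G (s := s) e_ge2 sX1.
- by rewrite cX1.
- by rewrite mono1 cards0.
set X2 := exec _ _ X1 in sX2 kX2 cX2 defX2 *.
have oX2 v : outset X2 v = outset X1 v by apply: outset_mark.
have p1 : (1 : R) <= (4 * p)%:R by rewrite ler1n muln_gt0.
have rho0 : 0 <= rho by rewrite invr_ge0.
have rho1 : rho <= 1 by rewrite invf_le1 // (lt_le_trans _ p1).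
have mX2 v : (mark (X2 v) <= 2)%N.
  by rewrite kX2; have := kX1 v; rewrite !inE => /orP[] /eqP->.
have [sX3 cX3 aX3 mX3 pX3] :=
  sweep_spec dec lam rho0 rho1 ports_G (iota 0 (2 ^ (3 * e))) sX2 mX2.
set X3 := exec _ _ X2 in sX3 cX3 aX3 mX3 pX3 *.
have {}mX3 v : (mark (X3 v) <= 1)%N by apply: mX3; rewrite mem_iota /= cX2.
have aX3' v : mark (X3 v) != 0%N -> mark (X v) != 0%N.
  by rewrite -aX1 -kX2; have := aX3 v; case: (mark (X3 v)); case: (mark (X2 v)).
pose X4 := step ports (discard p D) X3; rewrite -[exec _ _ X3]/X4.
have mX4 v : mark (X4 v) = (mark (X3 v) != 0%N) && (2 * p * #|bichromatic X3 v| < D)%N :> nat.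
  by rewrite /X4 /step /discard /= (count_outs ports_G _ _ sX3).
have sX4 : static X4 by move=> v; apply: sX3.
split=> [//|v|v|].
- by rewrite mX4 leq_b1.
- rewrite mX4 eqb0 negbK => /andP[mv bD].
  (* No zero mark becomes nonzero after [X2], so the defect of [X2] covers the remaining
     out-neighbours of equal colour. *)
  have oX4 : outset X4 v \subset bichromatic X3 v :|: mono X2 v.
    apply/subsetP => u; rewrite !inE mX4 eqb0 negbK !cX3 => /and3P[-> mu _] /=.
    by rewrite mu -leqn0 -ltnNge (leq_trans _ (aX3 u)) ?lt0n //; case: eqP.
  have := leq_trans (subset_leq_card oX4) (leq_card_setU _ _).
  have := defX2 v.
  have := dX v (aX3' v mv); rewrite -oX1 -oX2; nia.
- apply: le_trans (_ : _ <= (8 * p)%:R * potential dec lam rho G h sw X2) _.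
    rewrite (eq_bigl (fun v => mark (X2 v) != 0%N)); last by move=> v; rewrite kX2 aX1.
    apply: potential_undecided => v; first by rewrite kX2.
    by rewrite kX2 oX2 oX1 aX1; apply: dX.
  rewrite ler_wpM2l //; apply: le_trans pX3 _; apply: le_trans (potential_decided mX3) _.
  by rewrite le_eqVlt; apply/orP; left; apply/eqP/eq_bigl => v; rewrite mX4 eqb0 negbK.
Qed.

End Stage.

(** * Peeling and successive thinning *)

(** When [v] stops rising, every vertex that ends at least as high is at the height of [v], and at
    most [4 * a] neighbours are. The vertices of height [n] are those not yet peeled off; each round
    at least halves their number. *)
Lemma peeling_spec (V : finType) (G : sgraph V) (ports : V -> seq V) a n X
    (X' := exec ports [seq peel (4 * a) i | i <- iota 0 n] X) :
  port_numbering G ports -> 0 < a -> forest_partition G a ->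
  (forall v, height (X v) = 0) ->
  [/\ forall v, height (X' v) <= n,
      forall v, [/\ nid (X' v) = nid (X v), color (X' v) = color (X v),
                    mark (X' v) = mark (X v) & wstr (X' v) = wstr (X v)],
      forall v, height (X' v) < n ->
        #|[set u | uparc G (fun u => height (X' u)) v u]| <= 4 * a
    & #|[set v | height (X' v) == n]| * 2 ^ n <= #|V| ].
Proof.
move=> ports_G a0 Ga X0; rewrite /X' {X'}; elim: n => [|n [hX fX dX cX]].
  split=> [v|//|//|] /=; first by rewrite X0.
  by rewrite muln1 max_card.
have -> : iota 0 n.+1 = rcons (iota 0 n) n by rewrite -cats1 -addn1 iotaD.
rewrite map_rcons -cats1 exec_cat /=.
set Y := exec _ _ X in hX fX dX cX *.
pose high v := (height (Y v) == n) &&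
   (4 * a < #|[set u in [set u | height (Y u) == n] | G v u]|).
have E v : step ports (peel (4 * a) n) Y v =
    if high v then Node n.+1 (nid (Y v)) (color (Y v)) (mark (Y v)) (wstr (Y v)) else Y v.
  rewrite {1}/step /peel (count_ports ports_G) /high.
  by congr (if _ && (_ < _) then _ else _); apply: eq_card => u; rewrite !inE andbC.
have hE v : height (step ports (peel (4 * a) n) Y v) = if high v then n.+1 else height (Y v).
  by rewrite E; case: ifP.
split=> [v|v|v|].
- by rewrite hE; case: ifP => // _; apply: leq_trans (hX v) _.
- by rewrite E; case: ifP => _; apply: fX.
- rewrite hE ltnS; case: ifP => [_|nhv _]; first by rewrite ltnn.
  have [hv|hv] := eqVneq (height (Y v)) n; last first.
    apply: leq_trans (dX v _); last by rewrite ltn_neqAle hv hX.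
    apply/subset_leq_card/subsetP => u; rewrite !inE /uparc !hE nhv.
    by case: ifP => // /andP[/eqP-> _] /andP[-> _]; rewrite hX.
  move: nhv; rewrite /high hv eqxx /= => /negbT; rewrite -leqNgt; apply: leq_trans.
  apply/subset_leq_card/subsetP => u; rewrite !inE /uparc !hE /high hv eqxx /=.
  move=> /andP[-> /=]; rewrite andbT.
  have := hX u; rewrite (ltnNge (4 * a)) leq_eqVlt; case: eqVneq => //= _ hu.
  by case: ifP => _; lia.
- apply: leq_trans cX; rewrite expnS mulnA leq_mul2r expn_eq0 /= mulnC.
  apply: leq_trans (few_high_degree [set u | height (Y u) == n] a0 Ga).
  rewrite leq_mul2l /=; apply/subset_leq_card/subsetP => v; rewrite !inE hE.
  case: ifP => [//|_ /eqP hv].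
  by have := hX v; rewrite hv ltnn.
Qed.

(** The argument counts the stages left: out-degrees start below [p ^ k] and end below
    [p ^ 0 = 1]. *)
Fixpoint stages (R : realType) (dec : bitseq -> R) (p e s k : nat) : seq instr :=
  if k is k'.+1 then stage dec p (p ^ k) e s ++ stages dec p e s k' else [::].

Lemma size_stages (R : realType) (dec : bitseq -> R) p e s k :
  size (stages dec p e s k) = k * (2 + s + 2 ^ (3 * e)).
Proof.
have sr i : size (reductions e i) = i by elim: i => //= i ->.
elim: k => //= k IH; rewrite !size_cat size_map size_iota sr IH /=; lia.
Qed.

Section Stages.
Variables (R : realType) (dec : bitseq -> R) (V : finType) (G : sgraph V) (ports : V -> seq V).
Hypothesis ports_G : port_numbering G ports.
Variables (h idn : V -> nat) (sw : V -> bitseq).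
Hypothesis sw_ge0 : (forall v, 0 <= dec (sw v))%R.
Variables (p e s : nat).
Hypotheses (p_gt0 : 0 < p) (pe : 8 * p <= 2 ^ e) (e_ge2 : 2 <= e).
Hypotheses (idn_inj : injective idn) (idn_lt : forall v, idn v < 2 ^ (3 * (e + s))).

Lemma stages_spec k X (X' := exec ports (stages dec p e s k) X) :
  static h idn sw X -> (forall v, mark (X v) <= 1) ->
  (forall v, mark (X v) != 0 -> #|outset G h X v| < p ^ k) ->
  [/\ forall v, mark (X' v) <= 1,
      forall v, mark (X' v) != 0 -> outset G h X' v = set0
    & (\sum_(v | mark (X v) != 0%N) dec (sw v) <=
      (8 * p)%:R ^+ k * \sum_(v | mark (X' v) != 0%N) dec (sw v))%R].
Proof.
rewrite /X' {X'}; elim: k X => [|k IH] X sX mX dX /=.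
  split=> [//|v /dX|]; last by rewrite expr0 mul1r.
  by rewrite ltnS leqn0 cards_eq0 => /eqP.
rewrite exec_cat.
have [|sX1 mX1 dX1 wX1] := stage_spec ports_G sw_ge0 p_gt0 (D := p ^ k.+1) (s := s) _ pe e_ge2
  idn_inj idn_lt sX mX dX.
  by rewrite expn_gt0 p_gt0.
have [|mX' dX' wX'] := IH _ sX1 mX1.
  by move=> v /dX1; rewrite expnS ltn_pmul2l.
split=> //; apply: le_trans wX1 _; rewrite exprS -mulrA ler_wpM2l //.
Qed.

End Stages.

(** * Execution of programs by message passing *)

(** The string [wstr] of variable length comes last and needs no delimiter. *)
Definition node_enc (b : nat) (q : node) : bitseq :=
  nat_bits b (height q) ++ nat_bits b (nid q) ++ nat_bits b (color q) ++
  nat_bits b (mark q) ++ wstr q.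

Definition node_dec (b : nat) (s : bitseq) : node :=
  Node (bits_nat (take b s)) (bits_nat (take b (drop b s)))
    (bits_nat (take b (drop b (drop b s)))) (bits_nat (take b (drop b (drop b (drop b s)))))
    (drop b (drop b (drop b (drop b s)))).

Definition fits (b : nat) (q : node) : bool :=
  [&& height q < 2 ^ b, nid q < 2 ^ b, color q < 2 ^ b, mark q < 2 ^ b & size (wstr q) <= b].

Lemma node_encK b q : fits b q -> node_dec b (node_enc b q) = q.
Proof.
case: q => h i c m w /and5P[/= hb ib cb mb _].
by rewrite /node_dec /node_enc /= !(take_size_cat, drop_size_cat) ?size_nat_bits ?nat_bitsK.
Qed.

Lemma size_node_enc b q : fits b q -> size (node_enc b q) <= 5 * b.
Proof. by case/and5P => _ _ _ _ wb; rewrite !size_cat !size_nat_bits; lia. Qed.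

Fixpoint all_fit (b : nat) (prog : seq instr) : Prop :=
  if prog is ins :: prog' then (forall q N, fits b q -> fits b (ins q N)) /\ all_fit b prog'
  else True.

Lemma all_fit_cat b prog1 prog2 :
  all_fit b prog1 -> all_fit b prog2 -> all_fit b (prog1 ++ prog2).
Proof. by elim: prog1 => //= I prog1 IH [? /IH H] /H. Qed.

Lemma all_fit_map b (F : nat -> instr) s :
  (forall i, i \in s -> forall q N, fits b q -> fits b (F i q N)) -> all_fit b (map F s).
Proof.
elim: s => //= i s IH H; split; first by apply: H; rewrite mem_head.
by apply: IH => j js; apply: H; rewrite inE js orbT.
Qed.

Section Compile.
Variables (R : realType) (dec : bitseq -> R) (c B : nat) (prog : nat -> nat -> seq instr).

(** As [dec] is an arbitrary function, a string denoting [x] is obtained by choice. *)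
Definition weight_string (b : nat) (x : R) : bitseq :=
  if pselect (representable dec b x) is left H then s2val (cid2 H) else [::].

Lemma weight_stringP b x : representable dec b x ->
  size (weight_string b x) <= b /\ dec (weight_string b x) = x.
Proof. by rewrite /weight_string; case: pselect => // H _; case: cid2. Qed.

(* A state consists of the number of nodes, the instructions still to be executed, and the
   node record. *)
Definition compile : algorithm R :=
  @Algorithm R (nat * seq instr * node)
    (fun n alpha i x _ => (n, prog n alpha, Node 0 i 0 1 (weight_string (logbits c n) x)))
    (fun st _ => node_enc (logbits B st.1.1) st.2)
    (fun st l => if st.1.2 is ins :: P
                 then (st.1.1, P, ins st.2 (map (node_dec (logbits B st.1.1)) l)) else st)
    (fun st => if st.1.2 is [::] then Some (mark st.2 == 1) else None).

Variables (V : finType) (ports : V -> seq V) (ident : V -> nat) (w : V -> R) (alpha : nat).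
Let b := logbits B #|V|.
Let P := prog #|V| alpha.

Definition initial (v : V) : node :=
  Node 0 (ident v) 0 1 (weight_string (logbits c #|V|) (w v)).

Definition global (Q : seq instr) (X : V -> node) : config compile V :=
  fun v => (#|V|, Q, X v).

(** All nodes hold the same remaining program and halt together, so no message is silenced while
    instructions remain. *)
Lemma round_global Q X : (forall v, fits b (X v)) ->
  round ports (global Q X) =
  if Q is ins :: Q' then global Q' (step ports ins X) else global Q X.
Proof.
move=> fX; case: Q => [|I Q] //; apply: funext => v; rewrite /round /= /global /=.
congr (_, _, I _ _); rewrite -map_comp; apply: eq_map => u /=.
by rewrite /msg /= node_encK.
Qed.

Lemma iter_round_global t Q X : all_fit b Q -> (forall v, fits b (X v)) ->
  iter t (round ports) (global Q X) = global (drop t Q) (exec ports (take t Q) X) /\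
  forall v, fits b (exec ports (take t Q) X v).
Proof.
elim: t Q X => [|t IH] Q X; first by rewrite drop0 take0.
rewrite iterSr => fQ fX; rewrite round_global //; case: Q fQ => [|I Q] /= fQ.
  exact: (IH [::] X).
by apply: IH => [|v]; [case: fQ|apply: fQ.1].
Qed.

Hypotheses (fitP : all_fit b P) (fit0 : forall v, fits b (initial v)).

Lemma run_compile t :
  run compile ports ident w alpha t = global (drop t P) (exec ports (take t P) initial) /\
  forall v, fits b (exec ports (take t P) initial v).
Proof. exact: iter_round_global. Qed.

Lemma congest_compile : congest compile ports ident w alpha (logbits (5 * B) #|V|).
Proof.
move=> t u v _; have [-> fX] := run_compile t.
rewrite /msg; case: ifP => // _; rewrite /= /logbits -mulnA; exact: size_node_enc.
Qed.

Lemma terminated_compile : terminated compile ports ident w alpha (size P).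
Proof. by move=> v; have [-> _] := run_compile (size P); rewrite drop_size. Qed.

Lemma computed_set_compile :
  computed_set compile ports ident w alpha (size P) =
  [set v | mark (exec ports P initial v) == 1].
Proof.
apply/setP => v; rewrite !inE; have [-> _] := run_compile (size P).
by rewrite drop_size take_size /=; case: (mark _ == 1).
Qed.

End Compile.

(** * Approximation by the total weight *)

(** No independent set outweighs the whole vertex set. *)
Lemma approx_of_total_weight (R : realType) (V : finType) (e : rel V) (w : V -> R) q X :
  (forall v, 0 <= w v)%R -> independent e X -> (\sum_v w v <= q * weight w X)%R ->
  is_approx e w q X.
Proof.
move=> w0 iX wX; split=> //; apply: le_trans wX.
rewrite /OPT; apply: (big_ind (fun x => x <= \sum_v w v)%R) => [|x y xw yw|Y _]; first exact: sumr_ge0.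
  by rewrite ge_max xw.
rewrite /weight big_mkcond; apply: ler_sum => v _; by case: ifP.
Qed.

(** For positive [k] and [alpha], [p = 2 ^ j] satisfies [4 * alpha < p ^ k] and
    [(p / 2) ^ k <= 4 * alpha]. The exponent [e = j + 3] gives [2 ^ e = 8 * p], and the number [s]
    of reductions gives [c * up_log 2 n <= e + s], so identifiers are admissible colours. *)
Definition mwis_program (R : realType) (dec : bitseq -> R) (c k n alpha : nat) : seq instr :=
  if alpha == 0 then [::] else
  let j := (trunc_log 2 (4 * alpha) %/ k).+1 in
  [seq peel (4 * alpha) i | i <- iota 0 (up_log 2 n).+1] ++
  stages dec (2 ^ j) (j + 3) (c * up_log 2 n - (j + 3)) k.

Lemma size_mwis_program (R : realType) (dec : bitseq -> R) c k n a : 0 < a ->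
  size (mwis_program dec c k n a) <=
  (up_log 2 n).+1 + k * (2 + c * up_log 2 n + 2 ^ 12 * 2 ^ (3 * (trunc_log 2 (4 * a) %/ k))).
Proof.
rewrite /mwis_program; case: a => // a _; cbv zeta; rewrite size_cat size_map size_iota size_stages.
rewrite leq_add2l leq_mul2l -expnD; apply/orP; right; apply: leq_add.
  by rewrite leq_add2l leq_subr.
by rewrite leq_exp2l //; lia.
Qed.

Lemma all_fit_mwis_program (R : realType) (dec : bitseq -> R) c k n a : 1 < n ->
  all_fit (logbits (3 * c + 2) n) (mwis_program dec c k n a).
Proof.
move=> n1; rewrite /mwis_program; case: eqP => // _.
have L0 : 0 < up_log 2 n by rewrite up_log_gt0.
set j := (_ %/ _).+1; rewrite /logbits; set L := up_log 2 n in L0 *; set b := _ * L.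
have bL : 2 * L <= b by rewrite leq_mul2r leq_addl orbT.
have bc : 2 * (c * L) + 2 <= b by rewrite /b; nia.
have b2 : 2 < 2 ^ b by rewrite -[X in X < _]expn1 ltn_exp2l //; lia.
have b1 : 1 < 2 ^ b by apply: leq_trans b2.
have b0 : 0 < 2 ^ b by rewrite expn_gt0.
apply: all_fit_cat.
  apply: all_fit_map => i; rewrite mem_iota /= add0n => iL q N fq.
  rewrite /peel; case: ifP => // _; move: fq => /and5P[_ *]; apply/and5P; split=> //=.
  apply: leq_ltn_trans (iL) _; apply: leq_ltn_trans (ltn_expl L (isT : 1 < 2)) _.
  by rewrite ltn_exp2l //; lia.
move: (2 ^ j) (j + 3) => p e {j}; elim: k => //= k IH; split.
  move=> q N /and5P[*]; apply/and5P; split=> //=; by case: ifP.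
apply: all_fit_cat => //; apply: all_fit_cat; last apply: all_fit_cat.
(* The bound on [s] kept in the induction limits the field exponents to [c * L]. *)
- have : c * L - e <= c * L - e by [].
  move: {1 3}(c * L - e) => s; elim: s => //= s IHs sL; split; last by apply: IHs; lia.
  move=> q N /and5P[*]; apply/and5P; split=> //=.
  set i := pick_point _ _ _.
  (* For arbitrary inputs a good point may be missing; [i] may then equal the field size, which
     costs one extra bit. *)
  have := pick_point_le (e + s) (color q) [seq color q' | q' <- outs q N].
  have := code_lt (e + s) (color q) i.
  rewrite -/i => ci il.
  apply: (@leq_trans (2 ^ (2 * (e + s).+1 + 1))); last by rewrite leq_exp2l //; lia.
  have -> : 2 ^ (2 * (e + s).+1 + 1) = 2 ^ (e + s).+1 * 2 ^ (e + s).+1 * 2.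
    by rewrite -expnD -expnSr addn1 mul2n addnn.
  move: (2 ^ (e + s).+1) ci il => F; nia.
- apply: all_fit_map => i _ q N; rewrite /decide; case: ifP => // _ /and5P[*].
  by apply/and5P; split=> //=; case: (_ <= _)%R.
- by split=> // q N /and5P[*]; apply/and5P; split=> //=; case: (_ && _).
Qed.

(** * Correctness of the complete program *)

Section Correctness.
Variables (R : realType) (dec : bitseq -> R) (c k : nat).
Hypothesis k_gt0 : 0 < k.
Variables (V : finType) (G : sgraph V) (ports : V -> seq V).
Hypothesis ports_G : port_numbering G ports.
Variables (alpha : nat) (ident : V -> nat) (w : V -> R).
Hypotheses (alpha_gt0 : 0 < alpha) (G_alpha : forest_partition G alpha).
Hypothesis w_ge0 : (forall v, 0 <= w v)%R.
Hypothesis w_rep : forall v, representable dec (logbits c #|V|) (w v).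
Hypothesis ident_valid : valid_ids (logbits c #|V|) ident.

Local Notation X := (exec ports (mwis_program dec c k #|V| alpha) (initial dec c ident w)).

(** Every edge is an upward arc in some direction, so survivors without surviving out-neighbours are
    independent. The factor is [(8 p) ^ k = 16 ^ k * 2 ^ (t * k)], where
    [2 ^ (t * k) <= 4 * alpha]. *)
Lemma mwis_program_correct :
  independent G [set v | mark (X v) == 1] /\
  (\sum_v w v <= (4 * 16 ^ k * alpha)%:R * weight w [set v | mark (X v) == 1])%R.
Proof.
rewrite /mwis_program (gtn_eqF alpha_gt0).
cbv zeta; set L := up_log 2 #|V|; set t := trunc_log 2 (4 * alpha) %/ k; rewrite exec_cat.
have [idn_inj idn_lt] := ident_valid.
have [hX fX dX cX] := @peeling_spec V G ports alpha L.+1 (initial dec c ident w)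
  ports_G alpha_gt0 G_alpha (fun _ => erefl).
set Y := exec _ _ _ in hX fX dX cX *.
pose h v := height (Y v); pose sw v := wstr (Y v).
have swE v : dec (sw v) = w v.
  by rewrite /sw; have [_ _ _ ->] := fX v; case: (weight_stringP (w_rep v)).
have sY : static h ident sw Y by move=> v; split=> //; case: (fX v).
have mY v : mark (Y v) = 1 by case: (fX v).
(* The extra peeling round empties the top layer, because [#|V| < 2 ^ L.+1]. *)
have hlt v : h v < L.+1.
  rewrite ltn_neqAle hX andbT; apply/negP => hv.
  have : 0 < #|[set u | height (Y u) == L.+1]|.
    by rewrite card_gt0; apply/set0Pn; exists v; rewrite inE.
  have : #|V| <= 2 ^ L by apply: up_logP.
  have := expn_gt0 2 L; rewrite expnS in cX; nia.
have ltD : 4 * alpha < (2 ^ t.+1) ^ k.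
  rewrite -expnM; apply: leq_trans (trunc_log_ltn _ (isT : 1 < 2)) _.
  by rewrite leq_exp2l // ltn_ceil.
have sw0 v : (0 <= dec (sw v))%R by rewrite swE.
have p0 : 0 < 2 ^ t.+1 by rewrite expn_gt0.
have pe : 8 * 2 ^ t.+1 <= 2 ^ (t.+1 + 3) by rewrite addnC expnD.
have idn_lt' v : ident v < 2 ^ (3 * (t.+1 + 3 + (c * L - (t.+1 + 3)))).
  by apply: leq_trans (idn_lt v) _; rewrite leq_exp2l // /logbits -/L; lia.
have e2 : 2 <= t.+1 + 3 by rewrite addn3.
have mY1 v : mark (Y v) <= 1 by rewrite mY.
have dY v : mark (Y v) != 0 -> #|outset G h Y v| < (2 ^ t.+1) ^ k.
  move=> _; apply: leq_ltn_trans ltD; apply: leq_trans (dX v (hlt v)).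
  by apply/subset_leq_card/subsetP => u; rewrite !inE => /andP[].
have [mZ oZ wZ] := stages_spec ports_G sw0 p0 pe e2 idn_inj idn_lt' sY mY1 dY.
move: mZ oZ wZ; set Z := exec _ _ Y => mZ oZ wZ.
have mZ1 v : (mark (Z v) == 1) = (mark (Z v) != 0).
  by case: (mark (Z v)) (mZ v) => [|[]].
split.
  apply/forall_inP => v; rewrite inE mZ1 => mv; apply/forall_inP => u; rewrite inE mZ1 => mu.
  apply/negP => Gvu.
  wlog huv : u v mu mv Gvu / h v <= h u => [W|].
    by case/orP: (leq_total (h v) (h u)); apply: W; rewrite // adj_sym.
  by have /setP/(_ u) := oZ v mv; rewrite !inE /uparc Gvu huv mu.
rewrite (eq_bigl (fun v => mark (Y v) != 0)) /=; last by move=> v; rewrite mY.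
under eq_bigr => v _ do rewrite -swE.
apply: le_trans wZ _.
under eq_bigr => v _ do rewrite swE.
rewrite [weight _ _](eq_bigl (fun v => mark (Z v) != 0)) /=; last by move=> v; rewrite inE mZ1.
rewrite ler_wpM2r ?sumr_ge0 // -natrX ler_nat.
rewrite -[8]/(2 ^ 3) -[16]/(2 ^ 4) -expnD -!expnM.
have : 2 ^ (t * k) <= 4 * alpha.
  apply: leq_trans (_ : 2 ^ trunc_log 2 (4 * alpha) <= _); last by rewrite trunc_logP //; lia.
  by rewrite leq_exp2l // leq_divM.
have -> : (3 + t.+1) * k = 4 * k + t * k by lia.
rewrite expnD; nia.
Qed.

End Correctness.

(** As [3 <= tau * k], the cube of [2 ^ t] is at most the power [tau] of [(2 ^ t) ^ k <= 4 * a]. The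
    other terms are absorbed because [A] and [Z] are at least 1. *)
Lemma round_bound (R : realType) (tau : R) (M c k n a : nat) : (0 < tau)%R ->
  (3 <= tau * k%:R)%R -> 0 < k -> 1 < n -> 0 < a ->
  (((up_log 2 n).+1 +
    k * (2 + c * up_log 2 n + M * 2 ^ (3 * (trunc_log 2 (4 * a) %/ k))))%:R <=
  (3 + k%:R * (2 + 2 * c%:R + M%:R * 4 `^ tau)) / ln 2 * (a%:R `^ tau * ln n%:R) :> R)%R.
Proof.
move=> tau0 k3 k0 n1 a0.
set L := up_log 2 n; set t := _ %/ k.
have ln2 : (0 < ln 2 :> R)%R by rewrite ln_gt0 // ltr1n.
have lnn : (ln 2 <= ln n%:R :> R)%R by rewrite ler_ln ?posrE ?ltr0n ?ler_nat //; lia.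
pose Z : R := (ln n%:R / ln 2)%R.
have Z1 : (1 <= Z)%R by rewrite ler_pdivlMr // mul1r.
(* Rounding up adds at most [1 <= Z]. *)
have LZ : (L%:R <= 2 * Z)%R.
  have L0 : 0 < L by rewrite up_log_gt0.
  suff : (L.-1%:R <= Z)%R by rewrite -[L in X in _ -> X]prednK // -natr1; lra.
  rewrite ler_pdivlMr // -[leLHS]mulrC mulr_natr -lnXn // -natrX.
  rewrite ler_ln ?posrE ?ltr0n ?expn_gt0 //; last by lia.
  rewrite ler_nat ltnW //.
  have := up_log_bounds (isT : 1 < 2) n1; rewrite -/L; by case/andP.
pose A : R := (a%:R `^ tau)%R.
have A1 : (1 <= A)%R.
  have -> : 1%R = (1 `^ tau)%R :> R by rewrite powR1.
  by rewrite ge0_ler_powR ?nnegrE ?ler1n // ltW.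
have tA : ((2 ^ (3 * t))%:R <= 4 `^ tau * A)%R.
  rewrite /A -powRM // -natrM.
  have ta : (2 ^ t) ^ k <= 4 * a.
    rewrite -expnM; apply: leq_trans (_ : 2 ^ trunc_log 2 (4 * a) <= _).
      by rewrite leq_exp2l // leq_divM.
    by rewrite trunc_logP //; lia.
  apply: le_trans (_ : _ <= ((2 ^ t) ^ k)%:R `^ tau)%R _; last first.
    by rewrite ge0_ler_powR ?nnegrE ?ler_nat // ltW.
  rewrite [X in (X `^ _)%R]natrX -powR_mulrn // -powRrM.
  rewrite mulnC expnM natrX -powR_mulrn // ler_powR ?ler1n ?expn_gt0 //.
  by rewrite mulrC.
have -> : ((3 + k%:R * (2 + 2 * c%:R + M%:R * 4 `^ tau)) / ln 2 * (A * ln n%:R) =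
  (3 + k%:R * (2 + 2 * c%:R + M%:R * 4 `^ tau)) * (A * Z))%R.
  by rewrite /Z; field; rewrite gt_eqF.
have AZ1 : (Z <= A * Z)%R by rewrite ler_peMl //; lra.
have AZ2 : (A <= A * Z)%R by rewrite ler_peMr //; lra.
have P0 : (0 <= 4 `^ tau :> R)%R by rewrite powR_ge0.
rewrite natrD natrM !natrD !natrM -natr1 [leRHS]mulrDl -mulrA lerD //; first by lra.
rewrite ler_wpM2l // !mulrDl; apply: lerD; first apply: lerD.
- by lra.
- by rewrite !mul1r -mulrDr ler_wpM2l //; lra.
- rewrite -mulrA ler_wpM2l //; apply: le_trans tA _.
  by rewrite ler_wpM2l.
Qed.

Local Open Scope ring_scope.

Theorem theorem4p7 (R : realType) (tau : R) (tau_gt0 : 0 < tau) (c : nat) :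
  exists (Capprox Crounds : R) (Cmsg : nat),
  forall dec : bitseq -> R,
  exists A : algorithm R,
  forall (V : finType) (G : sgraph V) (alpha : nat) (w : V -> R)
         (ident : V -> nat) (ports : V -> seq V),
    is_arboricity G alpha ->
    (forall v, 0 <= w v) ->
    (forall v, representable dec (logbits c #|V|) (w v)) ->
    valid_ids (logbits c #|V|) ident ->
    port_numbering G ports ->
    congest A ports ident w alpha (logbits Cmsg #|V|) /\
    exists T : nat,
      [/\ T%:R <= Crounds * (alpha%:R `^ tau * ln #|V|%:R),
          terminated A ports ident w alpha T
        & is_approx G w (Capprox * (maxn 1 alpha)%:R)
            (computed_set A ports ident w alpha T)].
Proof.
(* A sweep takes order [p ^ 3] rounds with [p ^ k] of order [alpha], so [3 / k <= tau] is wanted. *)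
pose k := Num.bound (3 / tau).
have k_gt : 3 / tau < k%:R by rewrite archi_boundP // divr_ge0 // ltW.
have k_gt0 : (0 < k)%N by rewrite -(ltr0n R); apply: lt_trans k_gt; rewrite divr_gt0.
have k3 : 3 <= tau * k%:R by rewrite -ler_pdivrMl // mulrC ltW.
exists (4 * 16 ^ k)%:R.
exists ((3 + k%:R * (2 + 2 * c%:R + (2 ^ 12)%:R * 4 `^ tau)) / ln 2).
exists (5 * (3 * c + 2))%N => dec.
exists (compile dec c (3 * c + 2) (mwis_program dec c k)).
move=> V G alpha w ident ports Ga w0 wr idv pG.
(* Without edges the round bound is 0; the empty program selects every node. *)
have [a0|a0] := posnP alpha.
  move: Ga; rewrite a0 => /arboricity0 noedge; split.
    by move=> t u v uv; have [_ pu] := pG u; rewrite pu in uv; case/negP: (noedge u v).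
  exists 0%N; split.
  - by rewrite powR0 ?gt_eqF // mul0r mulr0.
  - by move=> v; rewrite /halted /=.
  - have -> : computed_set (compile dec c (3 * c + 2) (mwis_program dec c k)) ports ident w 0 0 =
        setT.
      by apply/setP => v; rewrite !inE.
    apply: approx_of_total_weight => //.
      by apply/forall_inP => v _; apply/forall_inP => u _.
    rewrite /weight [X in _ <= _ * X](eq_bigl predT) => [|v]; last by rewrite inE.
    by rewrite mulr1 ler_peMl ?sumr_ge0 // ler1n muln_gt0 expn_gt0.
(* With two vertices [up_log 2 #|V|] is positive, so messages have room for a record. *)
have n1 := arboricity_gt0 Ga a0.
have fitP := all_fit_mwis_program dec c k alpha n1.
have fit0 v : fits (logbits (3 * c + 2) #|V|) (initial dec c ident w v).
  have [_ idlt] := idv; have [sz _] := weight_stringP (wr v).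
  have L0 : (0 < up_log 2 #|V|)%N by rewrite up_log_gt0.
  have cb : (logbits c #|V| <= logbits (3 * c + 2) #|V|)%N by rewrite leq_mul2r; lia.
  apply/and5P; split=> /=; rewrite ?expn_gt0 //.
  - by apply: leq_trans (idlt v) _; rewrite leq_exp2l.
  - by rewrite -[X in (X < _)%N](expn0 2) ltn_exp2l // muln_gt0 L0 addn2.
  - exact: leq_trans sz cb.
split; first exact: congest_compile.
exists (size (mwis_program dec c k #|V| alpha)); split.
- apply: le_trans (round_bound (2 ^ 12) c tau_gt0 k3 k_gt0 n1 a0).
  by rewrite ler_nat size_mwis_program.
- exact: terminated_compile.
- rewrite computed_set_compile //.
  have [indep big] := mwis_program_correct k_gt0 pG a0 Ga.1 w0 wr idv.
  apply: approx_of_total_weight => //.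
  by rewrite -natrM (maxn_idPr a0).
Qed.
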